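(* Let $X$ be an infinite Tychonoff space. The following statements are equivalent: \begin{enumerate} \item $C_p(X)$ satisfies $S_{1}(\mathcal{A},\mathcal{A})$; \item $X$ satisfies $S_{1}(\mathcal{O},\mathcal{O})$ (the Rothberger property); \item $C_p(X)$ satisfies $S_{1}(\mathcal{A}_f,\mathcal{A}_f)$ for every $f\in C(X)$; \item $C_p(X)$ satisfies $S_{1}(\mathcal{A},\mathcal{A}_f)$ for every $f\in C(X)$; \item $C_p(X)$ satisfies $S_{1}(\mathcal{D},\mathcal{A})$; \item $C_p(X)$ satisfies $S_{1}(\{\mathcal{A}_n\}_{n\in\mathbb{N}},\mathcal{A})$; \item $C_p(X)$ satisfies $S_{1}(\{\mathcal{A}_{n,f}\}_{n\in\mathbb{N}},\mathcal{A}_f)$ for every $f\in C(X)$; \item $C_p(X)$ satisfies $S_{1}(\{\mathcal{A}_n\}_{n\in\mathbb{N}},\mathcal{A}_f)$ for every $f\in C(X)$. \end{enumerate}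
   Context: $\mathbb{N}$ is the set of positive integers. $C(X)$ is the set of continuous functions $X\to\mathbb{R}$, and $C_p(X)$ is $C(X)$ with the topology of pointwise convergence. Covers: a cover $\mathcal{U}$ of $X$ is always nontrivial, i.e. $X=\bigcup\mathcal{U}$ and $X\notin\mathcal{U}$. $\mathcal{O}$ is the family of all open covers of $X$. Families of subsets of $C_p(X)$: - $\mathcal{D}$ is the family of dense subsets of $C_p(X)$. - For $n\in\mathbb{N}$, a set $A\subseteq C_p(X)$ is $n$-dense in $C_p(X)$ if for all pairwise distinct $x_1,\dots,x_n\in X$ and all nonempty open sets $W_1,\dots,W_n\subseteq\mathbb{R}$ there is $f\in A$ with $f(x_i)\in W_i$ for $i=1,\dots,n$. $\mathcal{A}_n$ is the family of $n$-dense subsets of $C_p(X)$, and $\mathcal{A}=\mathcal{A}_1$. - For $f\in C(X)$ and $n\in\mathbb{N}$, a set $B\subseteq C_p(X)$ is $n$-dense at the point $f$ if for every $n$-element set $\{x_1,\dots,x_n\}\subseteq X$ and every $\epsilon>0$ there is $h\in B$ with $h(x_i)\in(f(x_i)-\epsilon,f(x_i)+\epsilon)$ for $i=1,\dots,n$. $\mathcal{A}_{n,f}$ is the family of subsets of $C_p(X)$ that are $n$-dense at $f$, and $\mathcal{A}_f=\mathcal{A}_{1,f}$. Selection principles: $S_1(\mathcal{P},\mathcal{Q})$ means: for each sequence $(P_n:n\in\mathbb{N})$ of elements of $\mathcal{P}$ there is a sequence $(b_n)_{n\in\mathbb{N}}$ with $b_n\in P_n$ for each $n$ and $\{b_n:n\in\mathbb{N}\}\in\mathcal{Q}$.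 For a sequence of families $\{\mathcal{P}_n\}_{n\in\mathbb{N}}$, $S_1(\{\mathcal{P}_n\}_{n\in\mathbb{N}},\mathcal{Q})$ means: for each sequence $(P_n:n\in\mathbb{N})$ with $P_n\in\mathcal{P}_n$ for each $n$, there is a sequence $(b_n)_{n\in\mathbb{N}}$ with $b_n\in P_n$ for each $n$ and $\{b_n:n\in\mathbb{N}\}\in\mathcal{Q}$. *)

(* Defs.v *)
From HB Require Import structures.
From mathcomp Require Import all_boot all_order all_algebra.
From mathcomp Require Import all_classical all_reals all_analysis.
Import Order.TTheory GRing.Theory Num.Theory.
Import numFieldNormedType.Exports.

Set Implicit Arguments.
Unset Strict Implicit.
Unset Printing Implicit Defensive.

Local Open Scope classical_set_scope.
Local Open Scope ring_scope.

(* The library's complete regularity is phrased with uniform structures;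
   [uniform_separatorP] turns it into separation by continuous functions. *)
Definition tychonoff_space (X : topologicalType) : Prop :=
  completely_regular_space X /\ hausdorff_space X.

(* [continuousType X R] is the set C(X); [Cp X R] is the same type with the
   topology induced by its inclusion into [{ptws X -> R}]. *)
Definition Cp (X : topologicalType) (R : realType) : topologicalType :=
  initial_topology
    (fun f : continuousType X R => (f : X -> R) : {ptws X -> R}).

(* Nontrivial open covers: [setT] itself is not allowed as a member. *)
Definition open_covers (X : topologicalType) : set (set (set X)) :=
  [set U | [/\ U `<=` open, cover U id = [set: X] & ~ U [set: X]]].
Arguments open_covers : clear implicits.

Definition dense_sets (X : topologicalType) (R : realType) :
    set (set (continuousType X R)) :=
  [set A | @dense (Cp X R) A].
Arguments dense_sets : clear implicits.

Definition ndense_sets (X : topologicalType) (R : realType) (n : nat) :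
    set (set (continuousType X R)) :=
  [set A | forall (x : 'I_n -> X) (W : 'I_n -> set R),
     injective x -> (forall i, open (W i) /\ W i !=set0) ->
     exists2 f : continuousType X R, A f & forall i, W i (f (x i))].
Arguments ndense_sets : clear implicits.

(* An n-element subset of X is given by an injective enumeration. *)
Definition ndense_sets_at (X : topologicalType) (R : realType) (n : nat)
    (f : continuousType X R) : set (set (continuousType X R)) :=
  [set B | forall (x : 'I_n -> X) (e : R), injective x -> 0 < e ->
     exists2 h : continuousType X R, B h &
       forall i, h (x i) \in `]f (x i) - e, f (x i) + e[].
Arguments ndense_sets_at {X R} n f.

Definition S1_seq (T : Type) (P : nat -> set (set T)) (Q : set (set T)) : Prop :=
  forall A : nat -> set T, (forall n, P n (A n)) ->
  exists b : nat -> T, (forall n, A n (b n)) /\ Q (range b).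

Definition S1 (T : Type) (P Q : set (set T)) : Prop := S1_seq (fun=> P) Q.

(* Main.v *)
(* In the nontrivial direction, the weakest principle needed is the selection,
   from a sequence of sets D_n that are dense and k-dense for all k, of a set
   1-dense at the constant function 1. Given open covers U_m, D_n consists of
   the functions vanishing outside a union of members of the covers in the n-th
   part of a partition of the indices into infinite parts; a function of D_n
   that is positive at x then tells that x lies in one of these members.
   Conversely, under the Rothberger property one selects, for each pair of a
   target function F_k and a tolerance 1/(m+1), along an infinite set of indices
   n, from the open sets {x : |h x - F_k x| < 1/(m+1)} with h in A_n; F_k = f
   yields 1-density at f, the rational constants yield 1-density. *)
Require Import Defs.
From mathcomp Require Import all_boot all_order all_algebra lra.
From mathcomp Require Import all_classical all_reals all_analysis.
Import Order.TTheory GRing.Theory Num.Theory.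
Import numFieldNormedType.Exports.

Local Open Scope classical_set_scope.
Local Open Scope ring_scope.

Lemma S1_seq_sub (T : Type) (P P' : nat -> set (set T)) (Q Q' : set (set T)) :
  (forall n, P' n `<=` P n) -> Q `<=` Q' -> S1_seq P Q -> S1_seq P' Q'.
Proof.
move=> PP QQ PQ A PA; have [n|b [Ab Qb]] := PQ A; first exact/PP/PA.
by exists b; split => //; exact: QQ.
Qed.

Lemma infinite_uniq_cons (T : choiceType) (x : T) (n : nat) :
  infinite_set [set: T] -> exists2 s : seq T, uniq (x :: s) & size s = n.
Proof.
move=> infT; elim: n => [|n [s us sn]]; first by exists [::].
have [y /negP ys] : exists y, ~ y \in x :: s.
  apply: contrapT => /forallNP all_s; apply: infT.
  apply: sub_finite_set (finite_seq (x :: s)) => z _ /=.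
  exact: contrapT (all_s z).
exists (y :: s); last by rewrite /= sn.
move: ys us; rewrite /= !inE negb_or => /andP[yx ->] /andP[xs ->].
by rewrite negb_or eq_sym yx xs.
Qed.

(** Pads one point to [n.+1] distinct points, so that density at [n.+1] points can be tested at a
    single one. *)
Lemma infinite_injective_ord0 (T : choiceType) (x : T) (n : nat) :
  infinite_set [set: T] ->
  exists2 y : 'I_n.+1 -> T, injective y & y ord0 = x.
Proof.
move=> /(infinite_uniq_cons _ x n)[s us sn].
exists (fun i => nth x (x :: s) i) => // i j /eqP.
by rewrite nth_uniq ?us //= ?sn // => /eqP/val_inj.
Qed.

(** * Comparison of the density notions *)

Section dense_families.
Context {R : realType} {X : topologicalType}.
Implicit Types f : continuousType X R.

Lemma ndense_sets_1 (n : nat) : infinite_set [set: X] ->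
  ndense_sets X R n.+1 `<=` ndense_sets X R 1.
Proof.
move=> infX A An x W _ WP.
have [y yinj yx] := infinite_injective_ord0 _ (x ord0) n infX.
have [f Af fW] := An y (fun=> W ord0) yinj (fun=> WP ord0).
by exists f => // i; rewrite ord1 -yx.
Qed.

Lemma ndense_sets_at_1 (n : nat) f : infinite_set [set: X] ->
  ndense_sets_at n.+1 f `<=` ndense_sets_at 1 f.
Proof.
move=> infX A An x e _ e0.
have [y yinj yx] := infinite_injective_ord0 _ (x ord0) n infX.
have [h Ah hf] := An y e yinj e0.
by exists h => // i; rewrite ord1 -yx.
Qed.

Lemma ndense_sets_sub_at (n : nat) f :
  ndense_sets X R n `<=` ndense_sets_at n f.
Proof.
move=> A An x e xinj e0.
have [i|h Ah hW] :=
    An x (fun i => [set` `]f (x i) - e, f (x i) + e[]) xinj.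
  split; first exact: interval_open.
  by exists (f (x i)); rewrite /= in_itv /= ltrBlDr ltrDl e0.
by exists h => // i; exact: hW.
Qed.

Lemma ndense_sets_at1P f (B : set (continuousType X R)) :
  ndense_sets_at 1 f B <->
  forall x (e : R), 0 < e -> exists2 h, B h & h x \in `]f x - e, f x + e[.
Proof.
split=> [Bf x e e0|Bf x e _ e0].
  have [i j _|h Bh hf] := Bf (fun=> x) e _ e0; first by rewrite !ord1.
  by exists h => //; exact: (hf ord0).
have [h Bh hf] := Bf (x ord0) e e0.
by exists h => // i; rewrite ord1.
Qed.

Definition cst_cts (c : R) : continuousType X R :=
  mkcts (@cst_continuous X R c).

Lemma dense_sets_1 : dense_sets X R `<=` ndense_sets X R 1.
Proof.
move=> A dA x W _ /(_ ord0)[oW [c Wc]].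
have oE : @open (Cp X R) [set f : continuousType X R | W ord0 (f (x ord0))].
  exists (proj (x ord0) @^-1` W ord0) => //.
  by apply: open_comp oW => g _; exact: proj_continuous.
have [|f [fW Af]] := dA _ _ oE; first by exists (cst_cts c).
by exists f => // i; rewrite ord1.
Qed.

(** A nonempty open set of reals contains a ball, and a rational near its centre can serve as target
    value, so countably many targets suffice. *)
Lemma ndense_sets_1_rat (A : set (continuousType X R)) :
  (forall q : rat, ndense_sets_at 1 (cst_cts (ratr q)) A) ->
  ndense_sets X R 1 A.
Proof.
move=> AQ x W _ /(_ ord0)[oW [c Wc]].
have /nbhs_ballP[e /= e0 eW] : nbhs c (W ord0) by exact: open_nbhs_nbhs.
(* The radius is shared between the distances from [c] to [q] and from [q] to [h x]. *)
have e20 : 0 < e / 2 by rewrite divr_gt0.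
have [|q] := @rat_in_itvoo R (c - e / 2) (c + e / 2).
  by rewrite ltrBlDr -addrA -splitr ltrDl.
rewrite in_itv /= => /andP[q1 q2].
have /ndense_sets_at1P/(_ (x ord0) _ e20)[h Ah] := AQ q.
rewrite in_itv /= => /andP[h1 h2].
exists h => // i; rewrite ord1; apply: eW; rewrite /ball /= ltr_norml.
by apply/andP; split; lra.
Qed.

End dense_families.
Arguments cst_cts {R} X c.

(** * Selections from the Rothberger property *)

Lemma rothberger_select (X : topologicalType) (T : Type) (A : nat -> set T)
    (V : T -> set X) :
  [set: X] !=set0 -> S1 (open_covers X) (open_covers X) ->
  (forall t, open (V t)) -> (forall n x, exists2 t, A n t & V t x) ->
  exists b : nat -> T, (forall n, A n (b n)) /\ forall x, exists n, V (b n) x.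
Proof.
move=> [x0 _] rX oV coverV.
have /choice[a Aa] : forall n, exists t, A n t.
  by move=> n; have [t] := coverV n x0; exists t.
(* The image of [A n] under [V] is a nontrivial cover unless it contains the whole space, in which
   case one such [t] suffices. *)
have [[n0 [t0 [At0 Vt0]]]|noV] :=
    pselect (exists n t, A n t /\ V t = [set: X]).
  exists (fun n => if n == n0 then t0 else a n); split => [n|x].
    by case: eqP => [->|].
  by exists n0; rewrite eqxx Vt0.
have [n|c [Uc [_ Vc _]]] := rX (fun n => V @` A n).
  split => [_ [t _ <-] //||[t At Vt]]; last by apply: noV; exists n, t.
  apply/seteqP; split => // x _; have [t At Vx] := coverV n x.
  by exists (V t) => //; exists t.
have /choice[b bP] : forall n, exists t, A n t /\ V t = c n.
  by move=> n; have [t At Vt] := Uc n; exists t.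
exists b; split => [n|x]; first by have [] := bP n.
have : cover (range c) id x by rewrite Vc.
by case=> _ [n _ <-] cx; exists n; have [_ ->] := bP n.
Qed.

(** Coding pairs [(k, m)] as indices gives each [k] a subsequence of its own, to which the case of a
    single [V] applies. *)
Lemma rothberger_select_countable (X : topologicalType) (T : Type)
    (K : countType) (k0 : K) (A : nat -> set T) (V : K -> T -> set X) :
  [set: X] !=set0 -> S1 (open_covers X) (open_covers X) ->
  (forall k t, open (V k t)) ->
  (forall k n x, exists2 t, A n t & V k t x) ->
  exists b : nat -> T,
    (forall n, A n (b n)) /\ forall k x, exists n, V k (b n) x.
Proof.
move=> X0 rX oV coverV.
have /choice[a Aa] : forall n, exists t, A n t.
  by move=> n; have [x _] := X0; have [t] := coverV k0 n x; exists t.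
have /choice[b bP] : forall k, exists b : nat -> T,
    (forall m, A (pickle (k, m)) (b m)) /\ forall x, exists m, V k (b m) x.
  by move=> k; exact: (rothberger_select X T (fun m => A (pickle (k, m))) (V k)).
(* Indices that code no pair receive an arbitrary choice. *)
exists (fun n => if pickle_inv n is Some (k, m) then b k m else a n).
split=> [n|k x].
  have := @pickle_invK (K * nat)%type n; case: pickle_inv => //= -[k m] <-.
  by have [] := bP k.
have [_ /(_ x)[m Vx]] := bP k.
by exists (pickle (k, m)); rewrite pickleK_inv.
Qed.

Lemma rothberger_S1_at (R : realType) (X : topologicalType) (K : countType)
    (k0 : K) (F : K -> continuousType X R) :
  [set: X] !=set0 -> S1 (open_covers X) (open_covers X) ->
  S1 [set A | forall k, ndense_sets_at 1 (F k) A]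
     [set A | forall k, ndense_sets_at 1 (F k) A].
Proof.
move=> X0 rX A AF.
pose V (k : K * nat) (h : continuousType X R) : set X :=
  [set x | `|h x - F k.1 x| < k.2.+1%:R^-1].
have [| |b [Ab bV]] := rothberger_select_countable _ _ _ (k0, 0%N) A V X0 rX.
- move=> k h; rewrite (_ : V k h =
    (fun x => `|h x - F k.1 x|) @^-1` [set y | y < k.2.+1%:R^-1]) //.
  apply: open_comp; last exact: open_lt.
  move=> x _; apply: (@continuous_comp _ _ _ (fun x => h x - F k.1 x) Num.norm).
    by apply: continuousB; exact: cts_fun.
  exact: norm_continuous.
- move=> k n x; have /ndense_sets_at1P := AF n k.1.
  move=> /(_ x k.2.+1%:R^-1)[//|h Ah hF].
  by exists h => //; rewrite /V /= ltr_distl; move: hF; rewrite in_itv.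
exists b; split => // k; apply/ndense_sets_at1P => x e e0.
have [m me] : exists m, m.+1%:R^-1 < e.
  near \oo => m; exists m; near: m; exact: near_infty_natSinv_lt (PosNum e0).
have [n bn] := bV (k, m) x; exists (b n); first by exists n.
by rewrite in_itv /= -ltr_distl (lt_trans bn).
Unshelve. all: by end_near. Qed.

(** * Interpolation, and the way back to open covers *)

Section interpolation.
Context {R : realType} {X : topologicalType}.

(** By induction on [s], the value at a new point [a] is corrected by a multiple of a function that
    is 1 at [a] and vanishes on [s] and outside [U]. *)
Lemma tychonoff_interpolation (s : seq X) (r : X -> R) (U : set X) :
  tychonoff_space X -> open U -> [set` s] `<=` U ->
  exists2 g : continuousType X R,
    {in s, g =1 r} & forall x, ~ U x -> g x = 0.
Proof.
move=> [crX /hausdorff_accessible/accessible_finite_set_closed T1 oU].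
elim: s => [|a s IHs] sU; first by exists (cst_cts X 0).
have [|g gr g0] := IHs.
  by move=> x /= xs; apply: sU; rewrite /= inE xs orbT.
have [as_|as_] := boolP (a \in s).
  exists g => // x; rewrite inE => /orP[/eqP ->|]; exact: gr.
have /(@uniform_separatorP _ R)[f [cf _ f0 f1]] :
    uniform_separator [set a] (~` U `|` [set` s]).
  apply: crX.
    by apply: closedU; [exact: open_closedC|exact: T1 (finite_seq s)].
  by case; [apply; apply: sU; exact: mem_head|exact: (negP as_)].
have fa : f a = 0 by apply: f0; exists a.
have fU x : ~ U x -> f x = 1 by move=> Ux; apply: f1; exists x => //; left.
have fs x : x \in s -> f x = 1 by move=> xs; apply: f1; exists x => //; right.
have ch : continuous (fun x => g x + (r a - g a) * (1 - f x)).
  move=> x; apply: continuousD; first exact: cts_fun.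
  apply: continuousM; first exact: cst_continuous.
  by apply: continuousB; [exact: cst_continuous|exact: cf].
exists (mkcts ch) => [x|x Ux]; rewrite /= /mkcts; last first.
  by rewrite fU // g0 // subrr mulr0 addr0.
rewrite inE => /orP[/eqP ->|xs]; first by rewrite fa subr0 mulr1 addrC subrK.
by rewrite fs // subrr mulr0 addr0 gr.
Qed.

(** The members of [D] that agree with [f] on a finite set form, as this set grows, a filter base
    converging pointwise to [f]; hence they enter every open set around [f]. *)
Lemma interpolating_dense (D : set (continuousType X R)) :
  (forall (s : seq X) (r : X -> R), exists2 g, D g & {in s, g =1 r}) ->
  dense_sets X R D.
Proof.
move=> interD O [f Of] [G oG GO].
pose B (s : seq X) : set {ptws X -> R} :=
  [set g | exists2 h : continuousType X R, D h &
     {in s, h =1 (f : continuousType X R)} /\ g = (h : X -> R)].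
have FB : Filter (filter_from setT B).
  apply: filter_from_filter; first by exists [::].
  move=> s t _ _; exists (s ++ t) => // _ [h Dh [hf ->]].
  by split; exists h => //; split => // x xs; apply: hf;
     rewrite mem_cat xs ?orbT.
have : filter_from setT B --> (f : {ptws X -> R}).
  (* The product topology is a supremum over coordinates, so one point [x] at a time is enough. *)
  apply/cvg_sup => x C [B2 [[W oW BW] B2f BC]].
  exists [:: x] => // g [h Dh [hf ->]]; apply: BC.
  by move: B2f; rewrite -BW /= hf ?mem_head.
move=> /(_ G)[|s _ sG].
  by apply: open_nbhs_nbhs; split => //; move: Of; rewrite -GO.
have [h Dh hf] := interD s f.
by exists h; split => //; rewrite -GO; apply: sG; exists h.
Qed.

Lemma interpolating_ndense (n : nat) (D : set (continuousType X R)) :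
  (forall (s : seq X) (r : X -> R), exists2 g, D g & {in s, g =1 r}) ->
  ndense_sets X R n D.
Proof.
move=> interD x W xinj WP.
have /choice[y yW] : forall i, exists c, W i c.
  by move=> i; have [] := WP i.
(* Injectivity of [x] makes [y i] the value prescribed at [x i]; 0 is a filler elsewhere. *)
have [g Dg gr] := interD (codom x)
  (fun z => if [pick i | x i == z] is Some i then y i else 0).
exists g => // i; rewrite gr ?codom_f //.
by case: pickP => [j /eqP/xinj -> //|/(_ i)]; rewrite eqxx.
Qed.

(* The m-th cover is used for the [D_n] with [n = d m]; as every fiber of [d]
   is infinite, any finite set is covered by members of distinct covers among
   those used for [D_n], so [D_n] is dense although the covers need not be
   closed under finite unions. *)
Lemma dense_select_rothberger : tychonoff_space X -> [set: X] !=set0 ->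
  S1 [set D | dense_sets X R D /\ forall n, ndense_sets X R n D]
     (ndense_sets_at 1 (cst_cts X 1)) ->
  S1 (open_covers X) (open_covers X).
Proof.
move=> tX [x0 _] S1D U Uc.
(* The default 0 can only add indices to the fiber of 0. *)
pose d (m : nat) : nat := if @unpickle (nat * nat)%type m is Some (n, _) then n else 0%N.
have dE (n i : nat) : d (pickle (n, i)) = n by rewrite /d pickleK.
pose D n : set (continuousType X R) := [set g | exists2 u : nat -> set X,
  forall m, U m (u m) & forall x, g x != 0 -> exists2 m, d m = n & u m x].
have UP m x : exists2 V, U m V & V x.
  have [_ Um _] := Uc m; have : cover (U m) id x by rewrite Um.
  by case=> V; exists V.
have interD n (s : seq X) (r : X -> R) : exists2 g, D n g & {in s, g =1 r}.
  (* Along each fiber of [d], [p] meets every point of [s]; choosing [u m] around [p m] makes the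
     union over the fiber contain [s]. *)
  pose p m := nth x0 s (if @unpickle (nat * nat)%type m is Some (_, i) then i else 0%N : nat).
  have /choice[u uP] : forall m, exists V, U m V /\ V (p m).
    by move=> m; have [V] := UP m (p m); exists V.
  have [||g gr g0] := tychonoff_interpolation s r
      (\bigcup_(m in [set m | d m = n]) u m) tX.
  - by apply: bigcup_open => m _; have [Uo _ _] := Uc m; apply: Uo (uP m).1.
  - move=> x xs; exists (pickle (n, index x s)); first exact: dE.
    by have := (uP (pickle (n, index x s))).2; rewrite /p pickleK nth_index.
  exists g => //; exists u => [m|x gx]; first exact: (uP m).1.
  have [[m]|/g0/eqP] := pselect ((\bigcup_(m in [set m | d m = n]) u m) x).
    by exists m.
  by rewrite (negbTE gx).
have [n|g [Dg g1]] := S1D D.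
  by split=> [|k]; [exact: interpolating_dense|exact: interpolating_ndense].
have /choice[u uP] : forall n, exists u : nat -> set X,
    (forall m, U m (u m)) /\
    forall x, g n x != 0 -> exists2 m, d m = n & u m x.
  by move=> n; have [u] := Dg n; exists u.
(* For the cover of index [m] only the witness attached to [g (d m)] is consulted, so each cover
   yields exactly one member. *)
exists (fun m => u (d m) m); split => [m|]; first exact: (uP (d m)).1.
split.
- by move=> _ [m _ <-]; have [Uo _ _] := Uc m; exact: Uo ((uP (d m)).1 m).
- apply/seteqP; split => // x _.
  (* Tolerance 1 around the value 1 forces [g n x] to be positive. *)
  have /ndense_sets_at1P/(_ x 1 ltr01)[_ [n _ <-]] := g1.
  rewrite in_itv /= subrr => /andP[gx _].
  have [m dm ux] := (uP n).2 x (lt0r_neq0 gx).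
  by exists (u (d m) m); [exists m|rewrite dm].
- by case=> m _ um; have [_ _] := Uc m; apply; rewrite -um; exact: (uP (d m)).1.
Qed.

End interpolation.

(* Sequences are indexed by nat, so the family at index n is the one for the
   positive integer n.+1. *)
Theorem theorem3p3 (R : realType) (X : topologicalType)
    (X_tychonoff : tychonoff_space X) (X_infinite : infinite_set [set: X]) :
  [<-> S1 (ndense_sets X R 1) (ndense_sets X R 1);
       S1 (open_covers X) (open_covers X);
       forall f : continuousType X R,
         S1 (ndense_sets_at 1 f) (ndense_sets_at 1 f);
       forall f : continuousType X R,
         S1 (ndense_sets X R 1) (ndense_sets_at 1 f);
       S1 (dense_sets X R) (ndense_sets X R 1);
       S1_seq (fun n => ndense_sets X R n.+1) (ndense_sets X R 1);
       forall f : continuousType X R,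
         S1_seq (fun n => ndense_sets_at n.+1 f) (ndense_sets_at 1 f);
       forall f : continuousType X R,
         S1_seq (fun n => ndense_sets X R n.+1) (ndense_sets_at 1 f)].
Proof.
have X0 : [set: X] !=set0 by exact: infinite_setN0.
have at1 f := @ndense_sets_sub_at R X 1 f.
(* These conditions on [P] and [Q] make the principle at least as strong as the weakest one, so
   every return to the Rothberger property goes through here. *)
have rothberger (P : nat -> set (set (continuousType X R))) Q :
    (forall n D, dense_sets X R D -> (forall k, ndense_sets X R k D) -> P n D) ->
    Q `<=` ndense_sets_at 1 (cst_cts X 1) ->
    S1_seq P Q -> S1 (open_covers X) (open_covers X).
  move=> DP Q1 PQ; apply: (@dense_select_rothberger R X X_tychonoff X0).
  by apply: S1_seq_sub Q1 PQ => n D [dD nD]; exact: DP.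
have rothberger_at : S1 (open_covers X) (open_covers X) ->
    forall f : continuousType X R, S1 (ndense_sets_at 1 f) (ndense_sets_at 1 f).
  move=> rX f; have := rothberger_S1_at R X unit tt (fun=> f) X0 rX.
  by apply: S1_seq_sub => [n A Af _ //|A]; exact.
have rothberger_ndense : S1 (open_covers X) (open_covers X) ->
    S1 (ndense_sets X R 1) (ndense_sets X R 1).
  move=> rX; have := rothberger_S1_at R X rat 0 (fun q => cst_cts X (ratr q)) X0 rX.
  by apply: S1_seq_sub => [n A An q|A]; [exact: at1|exact: ndense_sets_1_rat].
(* The implications form a cycle in the listed order. From the third statement to the fourth and
   from the seventh to the eighth, inclusions of families suffice; the others use the Rothberger
   property. *)
tfae.
- by apply: rothberger => // n D _; exact.
- exact: rothberger_at.
- by move=> + f => /(_ f); apply: S1_seq_sub => // n; exact: at1.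
- move=> /(_ (cst_cts X 1)) S.
  have /rothberger_ndense : S1 (open_covers X) (open_covers X).
    by apply: rothberger S => // n D _; exact.
  by apply: S1_seq_sub => // n; exact: dense_sets_1.
- move=> S; have /rothberger_ndense : S1 (open_covers X) (open_covers X).
    by apply: rothberger S.
  by apply: S1_seq_sub => // n; exact: ndense_sets_1.
- move=> S f; have /rothberger_at/(_ f) : S1 (open_covers X) (open_covers X).
    by apply: rothberger S => // n D _; exact.
  by apply: S1_seq_sub => // n; exact: ndense_sets_at_1.
- move=> + f => /(_ f); apply: S1_seq_sub => // n; exact: ndense_sets_sub_at.
- move=> /(_ (cst_cts X 1)) S; apply: rothberger_ndense.
  by apply: rothberger S => // n D _; exact.
Qed.
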